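(* Let $G$ be a finite group and $K$ a finite field of characteristic $p$ with $p\mid |G|$. Suppose the group algebra $KG$ contains an LCD and MDS group code $C$. Then $d(C)\geq p^m+1$, where $p^m$ is the order of a Sylow $p$-subgroup of $G$.
   Context: For a finite field $K$ and a finite group $G$, $KG=\{\sum_{g\in G}a_g g : a_g\in K\}$ is the group algebra with its usual addition and multiplication. A group code is a right ideal $C$ of $KG$, viewed as a linear code of length $n=|G|$ over $K$ with weight $wt(a)=|\{g\in G: a_g\neq 0\}|$. The minimum distance $d(C)$ is the minimum weight of a nonzero element of $C$. The inner product on $KG$ is $\langle a,b\rangle=\sum_{g\in G}a_g b_g$, and $C^\perp=\{b\in KG:\langle a,b\rangle=0\ \forall a\in C\}$. $C$ is LCD (linear complementary dual) if $C\cap C^\perp=\{0\}$. $C$ is MDS (maximum distance separable) if $d(C)=n-\dim_K(C)+1$.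
   Formalization: The group code C is assumed different from KG: the whole algebra KG is itself LCD and MDS with d(KG) = 1, so the claim fails for it; the zero code is given minimum distance n + 1. *)

(* Defs.v *)
From HB Require Import structures.
From mathcomp Require Import all_boot all_order all_algebra.
From mathcomp Require Import all_fingroup all_solvable all_field.

Set Implicit Arguments.
Unset Strict Implicit.
Unset Printing Implicit Defensive.

Import GRing.Theory.
Local Open Scope ring_scope.

(* The element \sum_(g : G) a_g g of KG is the finite function g |-> a_g. The
   alias keeps the convolution product apart from the pointwise product which
   the library puts on finite functions; K^o provides the K-space structure. *)
Definition grpalg (K : finFieldType) (G : finGroupType) : Type :=
  {ffun G -> K^o}.

Section GroupAlgebra.

Variables (K : finFieldType) (G : finGroupType).
Local Notation KG := (grpalg K G).

HB.instance Definition _ := Finite.copy KG {ffun G -> K^o}.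
HB.instance Definition _ := Vector.copy KG {ffun G -> K^o}.

Definition gcoef (a : KG) (g : G) : K := (a : {ffun G -> K^o}) g.

Definition gone : KG := [ffun g => (g == 1%g)%:R].

(* (\sum_h a_h h) (\sum_k b_k k) has coefficient \sum_(h k = g) a_h b_k at g. *)
Definition gmul (a b : KG) : KG :=
  [ffun g => \sum_(h : G) gcoef a h * gcoef b (h^-1 * g)%g].

Lemma gcoefP (a b : KG) : gcoef a =1 gcoef b -> a = b.
Proof. by move=> ab; apply/ffunP => g; apply: ab. Qed.

Lemma gcoefD (a b : KG) g : gcoef (a + b) g = gcoef a g + gcoef b g.
Proof. exact: ffunE. Qed.

Lemma gcoefZ (c : K) (a : KG) g : gcoef (c *: a) g = c * gcoef a g.
Proof. exact: ffunE. Qed.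

Lemma gcoef0 g : gcoef 0 g = 0.
Proof. exact: ffunE. Qed.

Lemma gcoef_one g : gcoef gone g = (g == 1%g)%:R.
Proof. exact: ffunE. Qed.

Lemma gcoef_mul (a b : KG) g :
  gcoef (gmul a b) g = \sum_(h : G) gcoef a h * gcoef b (h^-1 * g)%g.
Proof. exact: ffunE. Qed.

Fact gmulA : associative gmul.
Proof.
move=> a b c; apply: gcoefP => g; rewrite !gcoef_mul.
under eq_bigr => h _ do rewrite gcoef_mul mulr_sumr.
under [RHS]eq_bigr => h _ do rewrite gcoef_mul mulr_suml.
rewrite [RHS]exchange_big /=; apply: eq_bigr => h _.
rewrite [RHS](reindex_inj (mulgI h)) /=; apply: eq_bigr => k _.
by rewrite mulKg invMg mulgA mulrA.
Qed.

Fact gmul1 : left_id gone gmul.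
Proof.
move=> a; apply: gcoefP => g; rewrite gcoef_mul (bigD1 1%g) //= big1 => [|h].
  by rewrite gcoef_one eqxx mul1r invg1 mul1g addr0.
by rewrite gcoef_one => /negPf ->; rewrite mul0r.
Qed.

Fact gmulr1 : right_id gone gmul.
Proof.
move=> a; apply: gcoefP => g; rewrite gcoef_mul (bigD1 g) //= big1 => [|h hg].
  by rewrite gcoef_one mulVg eqxx mulr1 addr0.
by rewrite gcoef_one -eq_mulVg1 (negPf hg) mulr0.
Qed.

Fact gmulDl : left_distributive gmul +%R.
Proof.
move=> a b c; apply: gcoefP => g; rewrite gcoefD !gcoef_mul -big_split /=.
by apply: eq_bigr => h _; rewrite gcoefD mulrDl.
Qed.

Fact gmulDr : right_distributive gmul +%R.
Proof.
move=> a b c; apply: gcoefP => g; rewrite gcoefD !gcoef_mul -big_split /=.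
by apply: eq_bigr => h _; rewrite gcoefD mulrDr.
Qed.

Fact gone_neq0 : gone != 0.
Proof.
apply/eqP => /(congr1 (fun a => gcoef a 1%g)).
by rewrite gcoef_one gcoef0 eqxx => /eqP; rewrite oner_eq0.
Qed.

HB.instance Definition _ := GRing.Zmodule_isNzRing.Build KG
  gmulA gmul1 gmulr1 gmulDl gmulDr gone_neq0.

Fact gscaleAl (c : K) (a b : KG) : c *: (a * b) = (c *: a) * b.
Proof.
apply: gcoefP => g; rewrite gcoefZ !gcoef_mul mulr_sumr.
by apply: eq_bigr => h _; rewrite gcoefZ mulrA.
Qed.

HB.instance Definition _ := GRing.Lmodule_isLalgebra.Build K KG gscaleAl.

Fact gscaleAr (c : K) (a b : KG) : c *: (a * b) = a * (c *: b).
Proof.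
apply: gcoefP => g; rewrite gcoefZ !gcoef_mul mulr_sumr.
by apply: eq_bigr => h _; rewrite gcoefZ mulrCA.
Qed.

HB.instance Definition _ := GRing.Lalgebra_isAlgebra.Build K KG gscaleAr.

End GroupAlgebra.

Section GroupCodes.

Variables (K : finFieldType) (G : finGroupType).
Local Notation KG := (grpalg K G).

(* Right ideals of KG are K-subspaces, because c *: a = a * c%:A. *)
Definition group_code (C : {vspace KG}) : Prop :=
  forall a b : KG, a \in C -> a * b \in C.

Definition wt (a : KG) : nat := #|[set g : G | gcoef a g != 0]|.

(* Weights are at most #|G|, so the index #|G|.+1 only matters for C = 0: it is
   the value of the minimum over the empty set. *)
Definition mindist (C : {vspace KG}) : nat :=
  \big[minn/#|G|.+1]_(a : KG | (a \in C) && (a != 0)) wt a.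

Definition ginner (a b : KG) : K := \sum_(g : G) gcoef a g * gcoef b g.

Definition dual_code (C : {vspace KG}) : {set KG} :=
  [set b | [forall a : KG, (a \in C) ==> (ginner a b == 0)]].

Definition LCD (C : {vspace KG}) : Prop :=
  [set a : KG | a \in C] :&: dual_code C = [set 0].

Definition MDS (C : {vspace KG}) : Prop :=
  mindist C = (#|G| - \dim C + 1)%N.

End GroupCodes.

(* Main.v *)
Require Import Defs.
From HB Require Import structures.
From mathcomp Require Import all_boot all_order all_algebra.
From mathcomp Require Import all_fingroup all_solvable all_field.

Set Implicit Arguments.
Unset Strict Implicit.
Unset Printing Implicit Defensive.

Import GRing.Theory.
Local Open Scope ring_scope.

(** Since C is LCD, KG is the direct sum of C and D = C^⊥, and the adjunction
    between right multiplications makes D a right ideal too. Both summands are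
    then projective KG-modules, so their restrictions to a Sylow p-subgroup P
    are free and have dimension divisible by |P| = p^m. As C is proper, D is
    nonzero, hence dim D >= p^m; and the MDS condition reads
    d(C) = dim D + 1.

    The proof below obtains dim D >= |P| without any module theory. A p-group
    acting linearly on a nonzero space in characteristic p fixes a nonzero
    vector ([pgroup_fixed_vector]). So D contains some v != 0 which is fixed by
    right multiplication by P. Being constant on the cosets gP, such a v is
    b * N, where N is the sum of the elements of P
    ([fixed_vector_mul_group_sum]). If b = c + a with c in C and a in D, then
    c * N lies in both C and D and vanishes, so that a * N = v != 0.
    Multiplication by a is then injective on the group algebra of P: its kernel
    there is stable under P, and were it nonzero, it would contain a nonzero
    fixed vector, that is a multiple of N, which a does not annihilate. It
    embeds a space of dimension |P| into D ([direct_summand_dim_ge]). *)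

(** * Elements of the group algebra *)

Section GroupAlgebra.

Variables (K : finFieldType) (G : finGroupType).
Local Notation KG := (grpalg K G).

Definition gbasis (x : G) : KG := [ffun g => (g == x)%:R].

Definition group_sum (P : {set G}) : KG := [ffun g => (g \in P)%:R].

Lemma gcoef_mul_gbasis (a : KG) x g :
  gcoef (a * gbasis x) g = gcoef a (g * x^-1)%g.
Proof.
rewrite gcoef_mul (bigD1 (g * x^-1)%g) //= big1 => [|h hg].
  by rewrite {2}/gcoef ffunE invMg invgK mulgKV eqxx mulr1 addr0.
rewrite {2}/gcoef ffunE; case: eqP => [def_x|]; last by rewrite mulr0.
by case/eqP: hg; rewrite -def_x invMg invgK mulKVg.
Qed.

Lemma mul_gbasis1 (a : KG) : a * gbasis 1%g = a.
Proof. by apply: gcoefP => g; rewrite gcoef_mul_gbasis invg1 mulg1. Qed.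

Lemma mul_gbasisM (a : KG) x y : a * gbasis (x * y)%g = a * gbasis x * gbasis y.
Proof. by apply: gcoefP => g; rewrite !gcoef_mul_gbasis invMg mulgA. Qed.

Lemma dim_grpalg : \dim {: KG} = #|G|.
Proof. by rewrite dimvf /dim /= muln1. Qed.

(** The orbit equation: the number of fixed vectors is congruent modulo p to
    the order of V, a positive power of #|K|, so that 0 is not alone. *)
Lemma pgroup_fixed_vector (p : nat) (P : {group G}) (V : {vspace KG}) :
    p \in [pchar K] -> (p.-group P)%g ->
    (forall a x, a \in V -> x \in P -> a * gbasis x \in V) -> V != 0%VS ->
  exists v : KG, [/\ v \in V, v != 0
    & forall x, x \in P -> v * gbasis x = v].
Proof.
move=> charK pP stabV nzV.
pose to :=
  @TotalAction G KG (fun a x => a * gbasis x) mul_gbasis1 mul_gbasisM.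
have actsV : [acts P, on [set a in V] | to]%g.
  apply/actsP => x Px a; rewrite !inE /=.
  apply/idP/idP => [aV|/stabV]; last exact.
  by rewrite -[a]mul_gbasis1 -(mulgV x) mul_gbasisM stabV ?groupV.
have := pgroup_fix_mod pP actsV.
have p_dvd_K : (p %| #|K|)%N.
  have cardK : #|K| = (p ^ logn p #|K|)%N := card_pprimeChar charK.
  rewrite cardK dvdn_exp // lt0n; apply: contraTneq (finNzRing_gt1 K) => log0.
  by rewrite cardK log0.
have p_dvd_V : (p %| #|[set a in V]|)%N.
  by rewrite cardsE card_vspace dvdn_exp // lt0n dimv_eq0.
rewrite (eqP p_dvd_V) => /esym/eqP p_dvd_fix.
have fix0 : 0 \in ('Fix_([set a in V] | to)(P))%g.
  by rewrite inE inE mem0v; apply/afixP => x _ /=; rewrite mul0r.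
have [v] : exists v, v \in (('Fix_([set a in V] | to)(P))%g :\ 0).
  apply/set0Pn; apply: contraL (pcharf_prime charK) => /eqP fixD0.
  have := cardsD1 0 ('Fix_([set a in V] | to)(P))%g.
  rewrite fix0 fixD0 cards0 => card1.
  by move: p_dvd_fix; rewrite card1 -/(dvdn p 1) dvdn1 => /eqP->.
case/setD1P=> nzv /setIP[]; rewrite inE => vV /afixP fixv.
by exists v; split.
Qed.

Lemma fixed_vector_coef (P : {set G}) (v : KG) g x :
  (forall y, y \in P -> v * gbasis y = v) -> x \in P ->
  gcoef v (g * x)%g = gcoef v g.
Proof.
by move=> fixv Px; rewrite -{1}(fixv x Px) gcoef_mul_gbasis mulgK.
Qed.

(** A transversal of the left cosets of P carries the coefficients of the left
    factor. *)
Lemma fixed_vector_mul_group_sum (P : {group G}) (v : KG) :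
    (forall x, x \in P -> v * gbasis x = v) ->
  exists b : KG, v = b * group_sum P.
Proof.
move=> fixv.
pose b : KG := [ffun g => if g == repr (g *: P)%g then gcoef v g else 0].
exists b; apply: gcoefP => g; rewrite gcoef_mul.
set r := repr (g *: P)%g.
have rP : r \in (g *: P)%g by apply: (mem_repr g); rewrite lcoset_refl.
have [x Px def_r] := lcosetP rP.
have eq_coset : (r *: P = g *: P)%g by apply/lcoset_eqP.
rewrite (bigD1 r) //= big1 => [|h neq_hr].
  rewrite /gcoef !ffunE eq_coset eqxx -/(gcoef v g) -/(gcoef v r) addr0.
  have -> : ((r^-1 * g)%g \in P) by rewrite -mem_lcoset eq_coset lcoset_refl.
  by rewrite mulr1 def_r (fixed_vector_coef _ fixv).
rewrite /gcoef !ffunE; case: eqP => [def_h|_]; last by rewrite mul0r.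
have [hgP|_] := boolP (_ \in P); last by rewrite mulr0.
have eq_h : (g *: P = h *: P)%g by apply/lcoset_eqP; rewrite mem_lcoset.
by case/eqP: neq_hr; rewrite /r eq_h.
Qed.

(** * The group algebra of a subgroup *)

Definition off_part (P : {set G}) (b : KG) : KG :=
  [ffun g => if g \in P then 0 else gcoef b g].

Fact off_part_is_linear (P : {set G}) : linear (off_part P).
Proof.
move=> c a b; apply: gcoefP => g; rewrite gcoefD gcoefZ /off_part.
rewrite [LHS]ffunE /gcoef !ffunE.
by case: ifP => _; rewrite ?mulr0 ?addr0.
Qed.

HB.instance Definition _ P :=
  GRing.isLinear.Build K KG KG _ (off_part P) (off_part_is_linear P).

(** For a subgroup P this is the group algebra of P, embedded in KG. *)
Definition supp_in (P : {set G}) : {vspace KG} := lker (linfun (off_part P)).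

Lemma mem_supp_in (P : {set G}) (b : KG) :
  reflect (forall g, g \notin P -> gcoef b g = 0) (b \in supp_in P).
Proof.
rewrite memv_ker lfunE /=; apply: (iffP eqP) => [b0 g gP|b0].
  by have := congr1 (fun a => gcoef a g) b0; rewrite /gcoef !ffunE (negPf gP).
apply: gcoefP => g; rewrite [LHS]ffunE gcoef0.
by case: ifPn => // /b0.
Qed.

(** Over a finite field the dimension can be read off from the number of
    elements, here the number of functions from P to K. *)
Lemma dim_supp_in (P : {set G}) : \dim (supp_in P) = #|P|.
Proof.
apply: (@expnI #|K|); first exact: finNzRing_gt1.
rewrite -card_vspace -(card_pffun_on (0 : K^o) (mem P) predT).
apply: eq_card => b; apply/mem_supp_in/pffun_onP => [b0|[suppb _] g gP].
  split=> //; apply/subsetP => g; rewrite inE; apply: contraR => /b0.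
  by move/eqP.
by apply/eqP; apply: contraR gP => nz; apply: (subsetP suppb).
Qed.

(** The kernel of the multiplication by a on the group algebra of P is stable
    under P, so it suffices to look at its fixed vectors, which are the
    multiples of [group_sum P]. *)
Lemma dim_group_code_ge (p : nat) (P : {group G}) (D : {vspace KG}) (a : KG) :
    p \in [pchar K] -> (p.-group P)%g -> group_code D -> a \in D ->
  a * group_sum P != 0 -> (#|P| <= \dim D)%N.
Proof.
move=> charK pP idealD aD nz_aN; pose f := linfun (a \*o idfun : KG -> KG).
have fE b : f b = a * b by rewrite lfunE.
have subD : (f @: supp_in P <= D)%VS.
  by apply/subvP => _ /memv_imgP[b _ ->]; rewrite fE idealD.
suff ker0 : (supp_in P :&: lker f = 0)%VS.
  by rewrite -dim_supp_in -(limg_dim_eq ker0) dimvS.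
apply/eqP; apply: contraR nz_aN => nz_ker.
have [b x|v [vE nzv fixv]] := pgroup_fixed_vector charK pP _ nz_ker.
  rewrite !memv_cap => /andP[/mem_supp_in b0].
  rewrite !(memv_ker f) !fE => /eqP ab0 Px.
  rewrite mulrA ab0 mul0r eqxx andbT; apply/mem_supp_in => g gP.
  by rewrite gcoef_mul_gbasis b0 // groupMr // groupV.
move: vE; rewrite memv_cap (memv_ker f) fE => /andP[/mem_supp_in v0].
have def_v : v = gcoef v 1%g *: group_sum P.
  apply: gcoefP => g; rewrite gcoefZ {3}/gcoef ffunE.
  have [gP|/v0->] := boolP (g \in P); last by rewrite mulr0.
  by rewrite mulr1 -{1}[g]mul1g (fixed_vector_coef _ fixv).
rewrite {1}def_v -scalerAr scaler_eq0 => /orP[/eqP c0|//].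
by case/eqP: nzv; rewrite def_v c0 scale0r.
Qed.

(** * Complemented right ideals *)

Lemma direct_summand_dim_ge (p : nat) (P : {group G}) (C D : {vspace KG}) :
    p \in [pchar K] -> (p.-group P)%g -> group_code C -> group_code D ->
    (C :&: D = 0)%VS -> (C + D = fullv)%VS -> D != 0%VS ->
  (#|P| <= \dim D)%N.
Proof.
move=> charK pP idealC idealD dxCD sumCD nzD.
have [v [vD nzv fixv]] := pgroup_fixed_vector charK pP (fun a x aD _ =>
  idealD a (gbasis x) aD) nzD.
have [b def_v] := fixed_vector_mul_group_sum fixv.
have /memv_addP[c cC [a aD def_b]] : b \in (C + D)%VS by rewrite sumCD memvf.
apply: (dim_group_code_ge charK pP idealD aD).
suff cN0 : c * group_sum P = 0.
  by move: nzv; rewrite def_v def_b mulrDl cN0 add0r.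
apply/eqP; rewrite -memv0 -dxCD memv_cap idealC //=.
have -> : c * group_sum P = v - a * group_sum P.
  by rewrite def_v def_b mulrDl addrK.
by rewrite rpredB // idealD.
Qed.

(** * The dual code *)

(** Right multiplication by c is adjoint to right multiplication by the image
    of c under inversion of group elements. *)
Lemma ginner_mulr (a b c : KG) :
  ginner a (b * c) = ginner (a * [ffun g => gcoef c g^-1%g] : KG) b.
Proof.
rewrite /ginner; under eq_bigr => g _ do rewrite gcoef_mul mulr_sumr.
rewrite exchange_big /=; apply: eq_bigr => h _.
rewrite gcoef_mul mulr_suml; apply: eq_bigr => g _.
by rewrite [X in _ = _ * X * _]ffunE invMg invgK mulrCA mulrC.
Qed.

Lemma ginnerC (a b : KG) : ginner a b = ginner b a.
Proof. by apply: eq_bigr => g _; rewrite mulrC. Qed.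

Fact ginner_is_linear (a : KG) : linear (ginner a : KG -> K^o).
Proof.
move=> c b d; rewrite /ginner scaler_sumr -big_split /=.
by apply: eq_bigr => g _; rewrite gcoefD gcoefZ mulrDr mulrCA.
Qed.

HB.instance Definition _ a :=
  GRing.isLinear.Build K KG K^o _ (ginner a : KG -> K^o) (ginner_is_linear a).

(** Orthogonality to C amounts to \dim C linear equations, one for each vector
    of a basis of C. *)
Definition basis_pairing (C : {vspace KG}) (b : KG) : 'rV[K]_(\dim C) :=
  \row_i ginner (vbasis C)`_i b.

Fact basis_pairing_is_linear C : linear (basis_pairing C).
Proof. by move=> c a b; apply/rowP => i; rewrite !mxE linearP. Qed.

HB.instance Definition _ C :=
  GRing.isLinear.Build K KG 'rV[K]_(\dim C) _ (basis_pairing C)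
    (basis_pairing_is_linear C).

Definition dual_space (C : {vspace KG}) : {vspace KG} :=
  lker (linfun (basis_pairing C)).

Lemma dual_spaceP (C : {vspace KG}) b :
  reflect (forall a, a \in C -> ginner a b = 0) (b \in dual_space C).
Proof.
rewrite memv_ker lfunE /=; apply: (iffP eqP) => [b0 a aC|b0].
  rewrite ginnerC (coord_vbasis aC) linear_sum big1 // => i _.
  have := congr1 (fun r : 'rV_ _ => r 0 i) b0; rewrite !mxE ginnerC => bi0.
  by rewrite linearZ /= bi0 scaler0.
by apply/rowP => i; rewrite !mxE b0 // vbasis_mem // mem_nth ?size_tuple.
Qed.

Lemma dual_space_code (C : {vspace KG}) :
  group_code C -> group_code (dual_space C).
Proof.
move=> idealC b c /dual_spaceP b0; apply/dual_spaceP => a aC.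
by rewrite ginner_mulr b0 // idealC.
Qed.

Lemma LCD_capv_dual (C : {vspace KG}) : LCD C -> (C :&: dual_space C = 0)%VS.
Proof.
move=> lcdC; apply/vspaceP => b; rewrite memv_cap memv0.
have := congr1 (fun A : {set KG} => b \in A) lcdC; rewrite !inE => <-.
congr (_ && _); apply/dual_spaceP/forall_inP => b0 a aC; first exact/eqP/b0.
exact/eqP/b0.
Qed.

(** C^⊥ is cut out by \dim C equations, so it has dimension at least
    #|G| - \dim C; if it meets C trivially, it is a complement of C. *)
Lemma LCD_addv_dual (C : {vspace KG}) :
  LCD C -> (C + dual_space C = fullv)%VS.
Proof.
move=> lcdC; apply/eqP; rewrite eqEdim subvf.
rewrite (dimv_disjoint_sum (LCD_capv_dual lcdC)).
rewrite -(limg_ker_dim (linfun (basis_pairing C)) fullv) capfv addnC leq_add2r.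
by rewrite (leq_trans (dimvS (subvf _))) // dimvf /dim /= mul1n.
Qed.

End GroupAlgebra.

(** * The minimum distance of an LCD and MDS code *)

Theorem theorem5 (G : finGroupType) (K : finFieldType) (p : nat)
    (charK : p \in [pchar K]) (p_dvd_G : (p %| #|G|)%N)
    (C : {vspace grpalg K G})
    (C_code : group_code C) (C_proper : C != fullv)
    (C_LCD : LCD C) (C_MDS : MDS C)
    (P : {group G}) (m : nat)
    (P_Syl : (p.-Sylow([set: G]) P)%g) (oP : #|P| = (p ^ m)%N) :
  (p ^ m + 1 <= mindist C)%N.
Proof.
have dxC := LCD_capv_dual C_LCD; have sumC := LCD_addv_dual C_LCD.
have nzD : dual_space C != 0%VS.
  by apply: contraNneq C_proper => D0; rewrite -sumC D0 addv0.
have dimD : (#|G| - \dim C)%N = \dim (dual_space C).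
  by rewrite -(dim_grpalg K) -sumC (dimv_disjoint_sum dxC) addKn.
rewrite C_MDS dimD leq_add2r -oP.
apply: (direct_summand_dim_ge charK (pHall_pgroup P_Syl) C_code _ dxC sumC nzD).
exact: dual_space_code.
Qed.
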